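(* Let $J$ be the ideal of a non-trivial tetrahedral curve $(a_1,\dots,a_6)$. (a) If the curve is, up to a permutation of the variables, of the form $(0,r,r,r,r,0)$, then $\operatorname{reg}(J)=2r+1$. (b) If the curve is minimal, let $a_m$ be a largest entry and $a_{m'}$ the entry of the opposite edge (opposite pairs: $\{a_1,a_6\}$, $\{a_2,a_5\}$, $\{a_3,a_4\}$). Then $\operatorname{reg}(J)=a_m+a_{m'}$, and this is strictly greater than the maximal weight of a facet. (c) If the curve is not minimal and not of the form in (a), then $\operatorname{reg}(J)$ equals the maximal weight of a facet.
   Context: $\operatorname{reg}$ denotes Castelnuovo–Mumford regularity. Let $k$ be a field, $R=k[a,b,c,d]$. The tetrahedral curve $(a_1,\dots,a_6)$ has ideal $(a,b)^{a_1}\cap(a,c)^{a_2}\cap(a,d)^{a_3}\cap(b,c)^{a_4}\cap(b,d)^{a_5}\cap(c,d)^{a_6}$; trivial if all $a_i=0$; permuting $a,b,c,d$ permutes the entries. Facets: $\{a_1,a_2,a_3\}$, $\{a_1,a_4,a_5\}$, $\{a_2,a_4,a_6\}$, $\{a_3,a_5,a_6\}$; the weight of a facet is the sum of its entries. A non-arithmetically Cohen–Macaulay tetrahedral curve is minimal if none of the following reductions applies: (A) $a_1+a_2\ge a_4$, $a_1+a_3\ge a_5$, $a_2+a_3\ge a_6$; (B) $a_1+a_4\ge a_2$, $a_1+a_5\ge a_3$, $a_4+a_5\ge a_6$; (C) $a_2+a_4\ge a_1$, $a_2+a_6\ge a_3$, $a_4+a_6\ge a_5$; (D) $a_3+a_5\ge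 a_1$, $a_3+a_6\ge a_2$, $a_5+a_6\ge a_4$ (i.e. a curve is minimal iff it is not arithmetically Cohen–Macaulay and none of the systems (A)–(D) holds). Arithmetically Cohen–Macaulay curves are not minimal. *)

(* Defs.v *)
From HB Require Import structures.
From mathcomp Require Import all_boot all_order all_algebra perm.
Set Implicit Arguments. Unset Strict Implicit. Unset Printing Implicit Defensive.
Import Order.TTheory GRing.Theory Num.Theory.

(* Variables of R = k[a,b,c,d] are indexed by 'I_4 : a = 0, b = 1, c = 2, d = 3.
   A monomial is given by its exponent vector e : 'I_4 -> nat.
   A monomial ideal of R is described by its membership predicate on monomials
   (a polynomial lies in a monomial ideal iff all its monomials do). *)
Definition va : 'I_4 := @Ordinal 4 0 isT.
Definition vb : 'I_4 := @Ordinal 4 1 isT.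
Definition vc : 'I_4 := @Ordinal 4 2 isT.
Definition vd : 'I_4 := @Ordinal 4 3 isT.

Definition monideal := ('I_4 -> nat) -> bool.

(* The tetrahedral curve ideal
   (a,b)^a1 ∩ (a,c)^a2 ∩ (a,d)^a3 ∩ (b,c)^a4 ∩ (b,d)^a5 ∩ (c,d)^a6 :
   a monomial lies in (x,y)^n iff e_x + e_y >= n. *)
Definition tetra_ideal (a1 a2 a3 a4 a5 a6 : nat) : monideal := fun e =>
  [&& a1 <= e va + e vb, a2 <= e va + e vc,
      a3 <= e va + e vd, a4 <= e vb + e vc,
      a5 <= e vb + e vd & a6 <= e vc + e vd].

(* Koszul complex K(a,b,c,d; J), homological degree i, internal degree j:
   basis elements  m e_S  with #|S| = i and m a monomial of J of degree j - i. *)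
Definition kbasis (J : monideal) (i j : nat) :
  seq ({set 'I_4} * {ffun 'I_4 -> 'I_j.+1}) :=
  filter (fun x : {set 'I_4} * {ffun 'I_4 -> 'I_j.+1} =>
     [&& i <= j, #|x.1| == i, (\sum_t nat_of_ord (x.2 t)) == j - i
       & J (fun t => nat_of_ord (x.2 t))])
   (enum (predT : pred ({set 'I_4} * {ffun 'I_4 -> 'I_j.+1}))).

Definition kdflt (j : nat) : {set 'I_4} * {ffun 'I_4 -> 'I_j.+1} :=
  (set0, [ffun => ord0]).

(* coefficient of  m' e_S'  in  d(m e_S) = sum_{s in S} (-1)^{#{t in S, t<s}} x_s m e_{S\s} *)
Definition kcoef (k : fieldType) (j : nat)
  (x y : {set 'I_4} * {ffun 'I_4 -> 'I_j.+1}) : k :=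
  (\sum_(s in x.1 | (y.1 == x.1 :\ s) &&
                    [forall t, nat_of_ord (y.2 t) == nat_of_ord (x.2 t) + (t == s)])
     (-1) ^+ #|[set t in x.1 | (nat_of_ord t < nat_of_ord s)%N]|)%R.

(* matrix of the Koszul differential K_i -> K_{i-1} in degree j (row convention;
   for i = 0 it is the zero matrix since S is empty) *)
Definition kdiff (k : fieldType) (J : monideal) (i j : nat) :
  'M[k]_(size (kbasis J i j), size (kbasis J i.-1 j)) :=
  \matrix_(r < size (kbasis J i j), c < size (kbasis J i.-1 j))
    kcoef k (nth (kdflt j) (kbasis J i j) r) (nth (kdflt j) (kbasis J i.-1 j) c).

(* graded Betti number beta_{i,j}(J) = dim_k Tor_i^R(J,k)_j = dim_k H_i(K(a,b,c,d;J))_j *)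
Definition betti (k : fieldType) (J : monideal) (i j : nat) : nat :=
  (size (kbasis J i j) - \rank (kdiff k J i j)) - \rank (kdiff k J i.+1 j).

Definition is_reg (k : fieldType) (J : monideal) (n : nat) : Prop :=
  (exists i j, betti k J i j <> 0 /\ j = i + n) /\
  (forall i j, betti k J i j <> 0 -> j <= i + n).

(* R/J arithmetically Cohen-Macaulay (for a curve in P^3): pd_R(R/J) = codim = 2,
   i.e. pd_R(J) <= 1, i.e. beta_{i,j}(J) = 0 for all i >= 2 (Auslander-Buchsbaum). *)
Definition ACM (k : fieldType) (J : monideal) : Prop :=
  forall i j, 2 <= i -> betti k J i j = 0.

Definition minimal_curve (k : fieldType) (a1 a2 a3 a4 a5 a6 : nat) : Prop :=
  ~ ACM k (tetra_ideal a1 a2 a3 a4 a5 a6) /\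
  ~ [&& a4 <= a1 + a2, a5 <= a1 + a3 & a6 <= a2 + a3] /\
  ~ [&& a2 <= a1 + a4, a3 <= a1 + a5 & a6 <= a4 + a5] /\
  ~ [&& a1 <= a2 + a4, a3 <= a2 + a6 & a5 <= a4 + a6] /\
  ~ [&& a1 <= a3 + a5, a2 <= a3 + a6 & a4 <= a5 + a6].

Definition max_facet_weight (a1 a2 a3 a4 a5 a6 : nat) : nat :=
  maxn (a1 + a2 + a3) (maxn (a1 + a4 + a5) (maxn (a2 + a4 + a6) (a3 + a5 + a6))).

(* up to a permutation of the variables, the curve is (0,r,r,r,r,0):
   the ideal is the image of the ideal of (0,r,r,r,r,0) under x_t |-> x_(s t) *)
Definition special_form (a1 a2 a3 a4 a5 a6 r : nat) : Prop :=
  exists s : {perm 'I_4}, forall e : 'I_4 -> nat,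
    tetra_ideal a1 a2 a3 a4 a5 a6 e = tetra_ideal 0 r r r r 0 (fun t => e (s t)).

(* entries a_1..a_6 indexed 0..5; opposite edge of index m is 5 - m *)
Definition entry (a1 a2 a3 a4 a5 a6 : nat) (m : nat) : nat :=
  nth 0 [:: a1; a2; a3; a4; a5; a6] m.

(* Main.v *)
Require Import Defs.
From mathcomp Require Import all_boot all_order all_algebra perm.
From mathcomp Require Import zify ring.
Set Implicit Arguments. Unset Strict Implicit. Unset Printing Implicit Defensive.
Import GRing.Theory.

(* Graded Betti numbers are computed one multidegree [al] at a time: the Koszul
   complex of [J] in multidegree [al] is the augmented chain complex of the
   simplicial complex of the [S] with x^(al - S) in [J].  For a tetrahedral curve
   write s_xy = al_x + al_y - a_xy.  If all s_xy >= 0, that complex is the clique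
   complex of a graph: the vertices are the x with al_x > 0 and s_xy > 0 for all
   y, the edges are the xy with s_xy > 1.  On at most four vertices its reduced
   homology can only come from the empty graph, a disconnected graph or a
   4-cycle; in each case the s_xy on the missing edges determine |al|.  A 4-cycle
   contributes |al| - 2 = a_e + a_e' for the opposite missing edges e, e'.  In the
   other cases |al| minus the homological degree is at most the larger of the
   facet weights and the sums of opposite entries, except for two disjoint edges,
   where this fails by one exactly for the curves (0,r,r,r,r,0). *)

(** * Koszul homology by multidegree *)

Section Koszul.
Variables (k : fieldType) (J : monideal).
Hypothesis Jup : forall e e' : 'I_4 -> nat, (forall t, e t <= e' t) -> J e -> J e'.

Implicit Types (al : {ffun 'I_4 -> nat}) (S T U : {set 'I_4}).

Definition face al S :=
  [forall t, (t \in S) <= al t] && J (fun t => al t - (t \in S)).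

Lemma eq_monideal e e' : e =1 e' -> J e = J e'.
Proof. by move=> ee; apply/idP/idP; apply: Jup => t; rewrite ee. Qed.

Lemma face_sub al S T : T \subset S -> face al S -> face al T.
Proof.
move=> sTS /andP[/forallP Sal JS]; have le t : (t \in T) <= (t \in S).
  by case: (boolP (t \in T)) => // /(subsetP sTS) ->.
apply/andP; split; first by apply/forallP => t; apply: leq_trans (le t) (Sal t).
by apply: Jup JS => t; apply: leq_sub2l.
Qed.

Definition mdeg j (x : {set 'I_4} * {ffun 'I_4 -> 'I_j.+1}) : {ffun 'I_4 -> nat} :=
  [ffun t => (x.2 t : nat) + (t \in x.1)].

(** The only candidate for a basis element of multidegree [al] with exterior part [T]. The default
    of [inord] is never reached when [al] has total degree [j]. *)
Definition kelt j al T : {set 'I_4} * {ffun 'I_4 -> 'I_j.+1} :=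
  (T, [ffun t => inord (al t - (t \in T))]).

Lemma sum_mem (T : {set 'I_4}) : \sum_t (t \in T : nat) = #|T|.
Proof. by rewrite -sum1_card [RHS]big_mkcond; apply: eq_bigr => t _; case: (t \in T). Qed.

Lemma kbasisP i j x : x \in kbasis J i j ->
  [/\ #|x.1| == i, \sum_t mdeg x t = j & face (mdeg x) x.1].
Proof.
rewrite mem_filter => /andP[/and4P[ij /eqP xi /eqP xj Jx] _]; split; first exact/eqP.
  under eq_bigr do rewrite ffunE.
  by rewrite big_split /= sum_mem xi xj subnK.
apply/andP; split; first by apply/forallP => t; rewrite ffunE leq_addl.
by rewrite (eq_monideal (e' := fun t => x.2 t)) // => t; rewrite ffunE addnK.
Qed.

Lemma kelt_kbasis i j al T : \sum_t al t = j -> 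
  (kelt j al T \in kbasis J i j) && (mdeg (kelt j al T) == al) =
  (face al T && (#|T| == i)).
Proof.
move=> alj; have le_al t : al t - (t \in T) < j.+1.
  by rewrite -alj (bigD1 t) //= ltnS; lia.
have valk t : (kelt j al T).2 t = al t - (t \in T) :> nat by rewrite ffunE inordK.
have degk : (mdeg (kelt j al T) == al) = [forall t, (t \in T) <= al t].
  apply/eqP/forallP => [<- t | Tal]; first by rewrite ffunE leq_addl.
  by apply/ffunP => t; rewrite ffunE valk subnK.
rewrite degk /face mem_filter mem_enum inE andbT /=.
case: (boolP [forall t, _]) => [/forallP Tal|]; last by rewrite andbF.
rewrite andbT /= (eq_monideal (e' := fun t => al t - (t \in T))) //; last first.
have /= sumk : \sum_t ((kelt j al T).2 t : nat) + #|T| = j.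
  rewrite -sum_mem -big_split; apply: etrans alj; apply: eq_bigr => t _.
  by apply: etrans (subnK (Tal t)); congr (_ + _); exact: valk.
rewrite andbC; case: J; rewrite ?andbF // !andbT; case: eqP => [Ti|_]; last by rewrite !andbF.
rewrite Ti in sumk; have ij : i <= j by rewrite -[j in _ <= j]sumk leq_addl.
by rewrite ij /= -(eqn_add2r i) sumk subnK // eqxx.
Qed.

(** [kelt] and the first projection are mutually inverse between faces of size [i] and basis
    elements of multidegree [al]. *)
Lemma sum_kbasis i j al (F : {set 'I_4} -> k) : \sum_t al t = j ->
  (\sum_(y <- kbasis J i j | mdeg y == al) F y.1 =
   \sum_(T | face al T && (#|T| == i)) F T)%R.
Proof.
move=> alj; transitivity (\sum_(y | (y \in kbasis J i j) && (mdeg y == al)) F y.1)%R.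
  rewrite big_filter_cond big_enum_cond; apply: eq_bigl => y.
  by rewrite mem_filter mem_enum !inE andbT.
rewrite (reindex_onto (kelt j al) fst); last first.
  case=> T m /andP[_ /eqP <-]; congr pair; apply/ffunP => t; apply: val_inj.
  by rewrite !ffunE /= addnK inordK.
by apply: eq_bigl => T; rewrite kelt_kbasis // eqxx andbT.
Qed.

(** Dividing by a variable that is a vertex stays in [J] and lowers the degree; once no vertex is
    left, the monomial is a minimal generator. *)
Lemma exists_vertexless al : face al set0 ->
  exists be : {ffun 'I_4 -> nat},
    [/\ forall t, be t <= al t, face be set0 & forall x, ~~ face be [set x]].
Proof.
have [n] := ubnP (\sum_t al t); elim: n al => // n IH al; rewrite ltnS => aln f0.
case: (pickP (fun x => face al [set x])) => [x|no]; last first.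
  by exists al; split=> // x; rewrite no.
move=> fx; pose be := [ffun t => al t - (t \in [set x])].
have fbe : face be set0.
  have /andP[/forallP _ Jx] := fx; apply/andP; split; first by apply/forallP => t; rewrite inE.
  by apply: Jup Jx => t; rewrite ffunE in_set0 subn0.
have ax : 0 < al x by have /andP[/forallP/(_ x)] := fx; rewrite inE eqxx.
case: (IH be) => //.
  apply: leq_trans aln; rewrite (bigD1 x) //= [X in _ < X](bigD1 x) //= ffunE inE eqxx.
  rewrite -addSn leq_add //; first by rewrite subn1 prednK.
  by apply: leq_sum => t _; rewrite ffunE leq_subr.
move=> ga [gabe f n0]; exists ga; split=> // t.
by apply: leq_trans (gabe t) _; rewrite ffunE leq_subr.
Qed.

Lemma is_reg_intro n : (exists i j, betti k J i j <> 0 /\ i + n <= j) ->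
  (forall i j, betti k J i j <> 0 -> j <= i + n) -> is_reg k J n.
Proof.
move=> [i [j [nz le]]] ub; split=> //; exists i, j; split=> //.
by apply/eqP; rewrite eqn_leq le ub.
Qed.

Local Open Scope ring_scope.

(** * Multigraded matrices and the Koszul differential *)

Lemma sum_nth i j (F : {set 'I_4} * {ffun 'I_4 -> 'I_j.+1} -> k) :
  \sum_(c < size (kbasis J i j)) F (nth (kdflt j) (kbasis J i j) c) =
  \sum_(y <- kbasis J i j) F y.
Proof. by rewrite (big_nth (kdflt j)) big_mkord. Qed.

(* The multigraded map between terms of the Koszul complex whose component of
   multidegree [al] has kernel [A al] on the faces of [al]. *)
Definition opmx (i i' j : nat) (A : {ffun 'I_4 -> nat} -> {set 'I_4} -> {set 'I_4} -> k) :
  'M[k]_(size (kbasis J i j), size (kbasis J i' j)) :=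
  \matrix_(r, c)
    let x := nth (kdflt j) (kbasis J i j) r in
    let y := nth (kdflt j) (kbasis J i' j) c in
    if mdeg y == mdeg x then A (mdeg x) x.1 y.1 else 0.

Lemma eq_opmx i i' j A B :
  (forall al S T, (\sum_t al t = j)%N -> face al S -> face al T ->
     #|S| = i -> #|T| = i' -> A al S T = B al S T) ->
  opmx i i' j A = opmx i i' j B.
Proof.
move=> AB; apply/matrixP => r c; rewrite !mxE /=.
have /kbasisP[/eqP xi xj xf] := mem_nth (kdflt j) (ltn_ord r).
have /kbasisP[/eqP yi _ yf] := mem_nth (kdflt j) (ltn_ord c).
by case: ifP => // /eqP yx; apply: AB => //; rewrite -yx.
Qed.

Lemma opmxD i i' j A B :
  opmx i i' j A + opmx i i' j B = opmx i i' j (fun al S T => A al S T + B al S T).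
Proof. by apply/matrixP => r c; rewrite !mxE /=; case: ifP => // _; rewrite addr0. Qed.

Lemma opmx0 i i' j : opmx i i' j (fun _ _ _ => 0) = 0.
Proof. by apply/matrixP => r c; rewrite !mxE /=; case: ifP. Qed.

Lemma opmx1 i j : opmx i i j (fun _ S T => (S == T)%:R) = 1%:M.
Proof.
apply/matrixP => r c; rewrite !mxE /=.
have ub : uniq (kbasis J i j) by rewrite filter_uniq ?enum_uniq.
rewrite -[r == c](nth_uniq (kdflt j) (ltn_ord r) (ltn_ord c) ub).
set x := nth _ _ r; set y := nth _ _ c.
case: (x =P y) => [-> | xy]; first by rewrite !eqxx.
case: eqP => // yx; case: eqP => // S; case: xy.
case: x y yx S => [S m] [T m'] /= yx ST; subst T; congr pair.
by apply/ffunP => t; apply: val_inj; have /ffunP/(_ t) := yx; rewrite !ffunE /=; lia.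
Qed.

Lemma mul_opmx i i' i'' j A B :
  opmx i i' j A *m opmx i' i'' j B =
  opmx i i'' j (fun al S U => \sum_(T | face al T && (#|T| == i')) A al S T * B al T U).
Proof.
apply/matrixP => r c; rewrite !mxE /=.
under eq_bigr do rewrite !mxE.
set x := nth _ _ r; set z := nth _ _ c.
rewrite (sum_nth i' (fun y => (if mdeg y == mdeg x then A (mdeg x) x.1 y.1 else 0) *
  (if mdeg z == mdeg y then B (mdeg y) y.1 z.1 else 0))).
have /kbasisP[_ xj _] := mem_nth (kdflt j) (ltn_ord r).
case: eqP => [zx | /eqP zx]; last first.
  apply: big1 => y _; case: (_ =P mdeg x) => [-> |]; last by rewrite mul0r.
  by rewrite (negPf zx) mulr0.
rewrite -(sum_kbasis i' (fun T => A (mdeg x) x.1 T * B (mdeg x) T z.1) xj).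
rewrite [RHS]big_mkcond; apply: eq_bigr => y _.
by case: eqP => [-> |]; rewrite ?mul0r // zx eqxx.
Qed.

Definition sgn (s : 'I_4) S : k := (-1) ^+ #|[set t in S | (t < s)%N]|.
Definition bd S T : k := \sum_(s in S | T == S :\ s) sgn s S.

Lemma kdiffE i j : kdiff k J i j = opmx i i.-1 j (fun _ => bd).
Proof.
apply/matrixP => r c; rewrite !mxE /=.
set x := nth _ _ r; set y := nth _ _ c.
(* Once the exterior parts differ by [s], the exponent condition in [kcoef] says that the
   multidegrees agree. *)
have adm s : s \in x.1 -> y.1 = x.1 :\ s ->
    [forall t, (y.2 t : nat) == (x.2 t + (t == s))%N] = (mdeg y == mdeg x).
  move=> sx yx; apply/forallP/eqP => [yxt | /ffunP yxt].
    apply/ffunP => t; rewrite !ffunE (eqP (yxt t)) yx !inE.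
    by case: (t =P s) => [-> | _]; rewrite ?sx /= -addnA.
  move=> t; have := yxt t; rewrite !ffunE yx !inE.
  case: (t =P s) => [-> | _] /=; first by rewrite sx addn0 => ->.
  by move/addIn->; rewrite addn0.
rewrite /kcoef /bd -[RHS]/(if mdeg y == mdeg x then \sum_(s in x.1 | y.1 == x.1 :\ s) sgn s x.1 else 0).
case: ifP => yx.
  apply: eq_bigl => s; case: (boolP (s \in x.1)) => //= sx.
  by case: eqP => //= ys; rewrite adm.
apply: big1 => s /and3P[sx /eqP ys]; by rewrite adm // yx.
Qed.

Lemma sgn_sq s S : sgn s S * sgn s S = 1.
Proof. by rewrite /sgn -expr2 sqrr_sign. Qed.

Lemma sgnD1 s t S : s \in S -> sgn t (S :\ s) = (-1) ^+ (s < t)%N * sgn t S.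
Proof.
move=> sS; rewrite /sgn; have <- : [set u in S | (u < t)%N] :\ s = [set u in S :\ s | (u < t)%N].
  by apply/setP => u; rewrite !inE andbA.
by rewrite [X in _ * _ ^+ X](cardsD1 s) inE sS /= exprD mulrA -expr2 sqrr_sign mul1r.
Qed.

Lemma sgnU1 x t S : x \notin S -> sgn t (x |: S) = (-1) ^+ (x < t)%N * sgn t S.
Proof.
by move=> xS; rewrite -[in RHS](setU1K xS) sgnD1 ?setU11 // mulrA -expr2 sqrr_sign mul1r.
Qed.

Lemma bdE S T : bd S T = \sum_(s in S) if T == S :\ s then sgn s S else 0.
Proof. by rewrite /bd big_mkcondr. Qed.

Lemma bd_neq0 S T : bd S T != 0 -> exists2 s, s \in S & T = S :\ s.
Proof.
move=> nz; case: (pickP (fun s => (s \in S) && (T == S :\ s))) => [s /andP[sS /eqP]|no].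
  by exists s.
by rewrite /bd big_pred0 ?eqxx in nz.
Qed.

(* Faces of a face are faces, so the restriction to faces can be dropped. *)
Lemma sum_bd_face al S i (F : {set 'I_4} -> k) : face al S -> #|S| = i ->
  \sum_(T | face al T && (#|T| == i.-1)) bd S T * F T = \sum_(s in S) sgn s S * F (S :\ s).
Proof.
move=> fS Si; transitivity (\sum_T bd S T * F T).
  rewrite big_mkcond; apply: eq_bigr => T _; case: ifP => // fT.
  case: (eqVneq (bd S T) 0) => [-> |/bd_neq0[s sS TS]]; first by rewrite mul0r.
  rewrite TS (face_sub _ fS) ?subsetDl //= in fT.
  by move: Si fT; rewrite (cardsD1 s S) sS => <-; rewrite eqxx.
under eq_bigr do rewrite /bd mulr_suml.
rewrite (exchange_big_dep (mem S)) /=; last by move=> ? ? _ /andP[].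
by apply: eq_bigr => s sS; rewrite sS (big_pred1 (S :\ s)).
Qed.

Lemma kdiff_kdiff i j : kdiff k J i.+1 j *m kdiff k J i j = 0.
Proof.
rewrite !kdiffE mul_opmx -(opmx0 i.+1 i.-1 j).
apply: eq_opmx => al S U _ fS _ Si _.
rewrite (sum_bd_face (i := i.+1) (fun T => bd T U)) //.
under eq_bigr do rewrite /bd mulr_sumr.
(* [F] is symmetric, while the sign it receives depends on which of [s], [t] is smaller, so the
   terms cancel in pairs. *)
pose F s t : k := (if U == S :\ s :\ t then sgn s S * sgn t S else 0).
have FC s t : F s t = F t s by rewrite /F setDDl setUC -setDDl mulrC.
transitivity (\sum_(s in S) \sum_(t in S) (if (s < t)%N then - F s t else if (t < s)%N then F s t else 0)).
  apply: eq_bigr => s sS; rewrite big_mkcond [RHS]big_mkcond /=; apply: eq_bigr => t _.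
  rewrite !inE /F; case: (t =P s) => [-> | /eqP ts]; first by rewrite ltnn /=; case: ifP.
  case: (boolP (t \in S)) => //= tS; rewrite sgnD1 //.
  by case: ltngtP ts => [||/val_inj->] //; rewrite ?eqxx // => _ _; case: ifP => _; rewrite ?oppr0 // ?expr1 ?mulN1r ?mul1r ?mulrN.
transitivity (\sum_(s in S) \sum_(t in S) (if (t < s)%N then F s t else 0) -
  \sum_(s in S) \sum_(t in S) (if (s < t)%N then F s t else 0)).
  rewrite -sumrB; apply: eq_bigr => s _; rewrite -sumrB; apply: eq_bigr => t _.
  by case: ltngtP => _; rewrite ?subr0 ?sub0r.
rewrite [X in _ - X]exchange_big /=; apply/eqP; rewrite subr_eq0; apply/eqP.
by do 2!apply: eq_bigr => ? _; rewrite FC.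
Qed.


(** * Vanishing of Betti numbers by contracting homotopies *)

(** The identity is a sum of two products through the adjacent differentials, so their ranks add up
    to at least the size of the basis. *)
Lemma betti_eq0 i j H H' :
  kdiff k J i j *m H + H' *m kdiff k J i.+1 j = 1%:M -> betti k J i j = 0%N.
Proof.
move=> hom; have := mxrank1 k (size (kbasis J i j)).
rewrite -hom => rk; apply/eqP; rewrite /betti -subnDA subn_eq0 -[leqLHS]rk.
apply: leq_trans (mxrank_add _ _) _.
by apply: leq_add; [apply: mxrankM_maxl | apply: mxrankM_maxr].
Qed.

(** Adjoining the apex is a contracting homotopy. The apex may vary with [al], since the homotopy is
    built in each multidegree separately. *)
Lemma betti_cone i j :
  (forall al, (\sum_t al t = j)%N -> face al set0 ->
     exists x, forall S, face al S -> #|S| = i -> face al (x |: S)) ->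
  betti k J i j = 0%N.
Proof.
move=> cone.
pose good al x := [forall S, face al S && (#|S| == i) ==> face al (x |: S)].
pose apex al := odflt va [pick x | good al x].
pose h al S T : k := if (apex al \notin S) && (T == apex al |: S) then sgn (apex al) T else 0.
apply: (betti_eq0 (H := opmx i.-1 i j h) (H' := opmx i i.+1 j h)).
rewrite !kdiffE !mul_opmx opmxD -opmx1.
apply: eq_opmx => al S U alj fS fU Si Ui.
rewrite (sum_bd_face (fun T => h al T U)) //.
have {cone} : good al (apex al).
  rewrite /apex; case: pickP => //= no.
  have [|x ax] := cone al alj; first by apply: face_sub fS; rewrite sub0set.
  by have /negP[] := negbT (no x); apply/forallP => T; apply/implyP=> /andP[fT /eqP]; apply: ax.
rewrite /h; move: (apex al) => x /forallP/(_ S)/implyP fxS.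
have {}fxS : face al (x |: S) by apply: fxS; rewrite fS Si /=.
(* If [x] is in [S], the cone over [S] is zero and the boundary term dropping [x] returns [S].
   Otherwise the boundary of [x |: S] contributes [S], and its other terms cancel the cone over the
   boundary of [S]. *)
case: (boolP (x \in S)) => xS /=.
  rewrite [X in _ + X]big1 ?addr0; last by move=> *; rewrite mul0r.
  rewrite (bigD1 x) //= big1 ?addr0; last first.
    by move=> s /andP[sS sx]; rewrite !inE eq_sym sx xS mulr0.
  rewrite !inE eqxx setD1K // eq_sym; case: eqP => [<-|]; last by rewrite mulr0.
  exact: sgn_sq.
have xSi : #|x |: S| = i.+1 by rewrite cardsU1 xS Si.
rewrite [X in _ + X](bigD1 (x |: S)) ?fxS ?xSi ?eqxx //= [X in _ + (_ + X)]big1 ?addr0; last first.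
  by move=> T /andP[_ /negPf->]; rewrite mul0r.
rewrite bdE big_setU1 //= setU1K // mulrDr addrCA big_distrr /= -big_split /=.
rewrite [X in _ + X]big1 ?addr0; last first.
  move=> s sS; have sx : s != x by apply: contraNneq xS => <-.
  rewrite !inE negb_and xS orbT /=.
  have -> : x |: S :\ s = (x |: S) :\ s.
    by apply/setP => t; rewrite !inE; case: (t =P x) => [->|] //=; rewrite eq_sym sx.
  case: eqP => [->|_]; last by rewrite !mulr0 addr0.
  rewrite sgnD1 ?setU11 ?inE ?sS ?orbT // !sgnU1 // ltnn mul1r.
  rewrite [_ * (_ * sgn s S)]mulrCA [_ * sgn x S]mulrC.
  case: ltngtP (sx) => [||/val_inj->]; rewrite ?eqxx // => _ _.
    by rewrite expr1 expr0 mul1r mulrN1 mulrN mulrC addNr.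
  by rewrite expr1 expr0 mulr1 mulN1r mulrC addrN.
by rewrite eq_sym; case: eqP => _; rewrite ?mulr0 ?sgn_sq.
Qed.

(** The oriented 1-simplex from [p] to [q], signed so that its boundary is [q] minus [p]. The value
    zero at [p = q] lets a path stand still. *)
Definition edge (p q : 'I_4) T : k :=
  if (p != q) && (T == [set p; q]) then (-1) ^+ (q < p)%N else 0.

Lemma sum_pair (p q : 'I_4) (F : 'I_4 -> k) : p != q ->
  \sum_(s in [set p; q]) F s = F p + F q.
Proof. by move=> pq; rewrite big_setU1 ?inE //= big_set1. Qed.

Lemma pairD1l (p q : 'I_4) : p != q -> [set p; q] :\ p = [set q].
Proof. by move=> pq; rewrite setU1K ?inE. Qed.

Lemma pairD1r (p q : 'I_4) : p != q -> [set p; q] :\ q = [set p].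
Proof. by move=> pq; rewrite setUC setU1K ?inE // eq_sym. Qed.

Lemma sgn1 (p : 'I_4) : sgn p [set p] = 1.
Proof.
rewrite /sgn; have -> : [set t in [set p] | (t < p)%N] = set0; last by rewrite cards0.
by apply/setP => t; rewrite !inE; case: eqP => // ->; rewrite ltnn.
Qed.

Lemma sgn_pairl (p q : 'I_4) : p != q -> sgn p [set p; q] = (-1) ^+ (q < p)%N.
Proof. by move=> pq; rewrite setUC sgnU1 ?inE 1?eq_sym // sgn1 mulr1. Qed.

Lemma sgn_pairr (p q : 'I_4) : p != q -> sgn q [set p; q] = - (-1) ^+ (q < p)%N.
Proof.
move=> pq; rewrite sgnU1 ?inE // sgn1 mulr1.
by case: ltngtP pq => [||/val_inj->]; rewrite ?eqxx // ?opprK.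
Qed.

Lemma bd_edge al p q U : p = q \/ face al [set p; q] ->
  \sum_(T | face al T && (#|T| == 2)) edge p q T * bd T U =
  (U == [set q])%:R - (U == [set p])%:R.
Proof.
case: (eqVneq p q) => [-> _|pq [/eqP|fpq]]; last 2 first.
- by rewrite (negPf pq).
- rewrite (bigD1 [set p; q]) ?fpq ?cards2 ?pq //= big1 ?addr0; last first.
    by move=> T /andP[_ /negPf nT]; rewrite /edge nT andbF mul0r.
  rewrite /edge pq eqxx bdE sum_pair // pairD1l // pairD1r // sgn_pairl // sgn_pairr //=.
  rewrite mulrDr; congr (_ + _).
    by case: eqP => _; rewrite ?mulr0 // -expr2 sqrr_sign.
  by case: eqP => _; rewrite ?mulr0 ?oppr0 // mulrN -expr2 sqrr_sign.
by rewrite addrN big1 // => T _; rewrite /edge eqxx mul0r.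
Qed.

(* Every vertex is joined to [x] by a path through [y], so the graph of the
   vertices and edges of [al] is connected. *)
Lemma betti1_connected j :
  (forall al v, (\sum_t al t = j)%N -> face al [set v] ->
     exists x y, face al [set x; y] /\
       forall w, face al [set w] -> face al [set x; w] \/ face al [set y; w]) ->
  betti k J 1 j = 0%N.
Proof.
move=> conn.
pose good al (c : 'I_4 * 'I_4) := face al [set c.1; c.2] &&
  [forall w, face al [set w] ==> face al [set c.1; w] || face al [set c.2; w]].
pose ctr al := odflt (va, va) [pick c | good al c].
(* The homotopy sends the empty face to the first centre, and a vertex [w] to a path from that
   centre through [nxt] to [w], whose boundary is [w] minus the centre. *)
pose base al S T : k := (T == [set (ctr al).1])%:R.
pose nxt al w := if face al [set (ctr al).1; w] then (ctr al).1 else (ctr al).2.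
pose path al S T : k := \sum_(w in S) (edge (nxt al w) w T + edge (ctr al).1 (nxt al w) T).
apply: (@betti_eq0 1 j (opmx 0 1 j base) (opmx 1 2 j path)).
rewrite !kdiffE !mul_opmx opmxD -opmx1.
apply: eq_opmx => al S U alj fS fU /eqP/cards1P[v Sv] _; rewrite {S}Sv in fS *.
rewrite (sum_bd_face (i := 1) (fun T => base al T U)) ?cards1 //.
have : good al (ctr al).
  rewrite /ctr; case: pickP => //= no.
  have [x [y [fxy cxy]]] := conn al v alj fS.
  have /negP[] := negbT (no (x, y)); rewrite /good fxy /=.
  by apply/forallP => w; apply/implyP => /cxy/orP.
have -> : \sum_(T | face al T && (#|T| == 2)) path al [set v] T * bd T U =
    \sum_(T | face al T && (#|T| == 2)) edge (nxt al v) v T * bd T U +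
    \sum_(T | face al T && (#|T| == 2)) edge (ctr al).1 (nxt al v) T * bd T U.
  by rewrite -big_split; apply: eq_bigr => T _; rewrite /path big_set1 mulrDl.
rewrite big_set1 sgn1 mul1r /base /nxt.
case: (ctr al) => x y /= /andP[fxy /forallP/(_ v)]; rewrite fS /= => fvxy.
rewrite !bd_edge.
- by rewrite addrC subrKA subrK eq_sym.
- by case: ifP => _; [left | right].
- by right; case: ifP fvxy.
Qed.

(** * Nonvanishing of Betti numbers by cycles and cocycles *)

(** The rows of [A] and of [E] lie in the left kernel of [B]. Their spans meet only in zero, since
    right multiplication by [E] kills the former and fixes the latter. *)
Lemma rank_split m n p (A : 'M[k]_(m, n)) (B : 'M_(n, p)) (E : 'M_n) :
  A *m B = 0 -> A *m E = 0 -> E *m B = 0 -> E *m E = E -> E != 0 ->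
  (\rank A + \rank B < n)%N.
Proof.
move=> AB AE EB EE E0; have capAE : (A :&: E = 0)%MS.
  apply/eqP; rewrite -submx0; have /submxP[X eX] := capmxSl A E.
  have /submxP[Y eY] := capmxSr A E.
  by rewrite eY -EE mulmxA -eY eX -mulmxA AE mulmx0 submx_refl.
have := mulmx0_rank_max (A := col_mx A E) (B := B).
rewrite mul_col_mx AB EB col_mx0 => /(_ erefl); apply: leq_trans.
rewrite -addsmxE mxrank_disjoint_sum // addnAC -addn1 leq_add2l.
by rewrite lt0n mxrank_eq0.
Qed.

(** The cocycle [u] vanishes on boundaries and pairs to 1 with the cycle [z], so [z] is not a
    boundary. *)
Lemma betti_neq0 i j al (z u : {set 'I_4} -> k) :
  (\sum_t al t)%N = j ->
  (forall U, face al U -> #|U| = i.-1 ->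
     \sum_(T | face al T && (#|T| == i)) z T * bd T U = 0) ->
  (forall S, face al S -> #|S| = i.+1 -> \sum_(s in S) sgn s S * u (S :\ s) = 0) ->
  \sum_(T | face al T && (#|T| == i)) z T * u T = 1 ->
  betti k J i j <> 0%N.
Proof.
move=> alj zcycle ucocycle zu.
(* A rank-one idempotent, supported in multidegree [al], splitting off a cycle. *)
pose E (be : {ffun 'I_4 -> nat}) S T := if be == al then u S * z T else 0.
have := @rank_split _ _ _ (kdiff k J i.+1 j) (kdiff k J i j) (opmx i i j E).
rewrite kdiff_kdiff => /(_ erefl) rk; suff lt_rk : (\rank (kdiff k J i.+1 j) +
    \rank (kdiff k J i j) < size (kbasis J i j))%N by rewrite /betti; lia.
apply: rk.
- rewrite kdiffE mul_opmx -(opmx0 i.+1 i j); apply: eq_opmx => be S U _ fS _ Si _.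
  rewrite (sum_bd_face (i := i.+1) (fun T => E be T U)) // /E.
  case: eqP fS => [-> fS | _ _]; last by apply: big1 => *; rewrite mulr0.
  by under eq_bigr do rewrite mulrA; rewrite -mulr_suml ucocycle ?mul0r.
- rewrite kdiffE mul_opmx -(opmx0 i i.-1 j); apply: eq_opmx => be S U _ _ fU _ Ui.
  rewrite /E; case: eqP fU => [-> fU | _ _]; last by apply: big1 => *; rewrite mul0r.
  by under eq_bigr do rewrite -mulrA; rewrite -mulr_sumr zcycle ?mulr0.
- rewrite mul_opmx; apply: eq_opmx => be S U _ _ _ _ _.
  rewrite /E; case: eqP => [-> | _]; last by apply: big1 => *; rewrite mul0r.
  under eq_bigr do rewrite mulrA -(mulrA (u S)).
  by rewrite -mulr_suml -mulr_sumr zu mulr1.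
case: (pickP (fun T => [&& face al T, #|T| == i & z T * u T != 0])) => [T|no]; last first.
  have /esym/eqP/idPn[] := zu; rewrite big1 ?oner_eq0 // => T fT.
  by apply/eqP; have := no T; rewrite andbA fT => /negbFE.
case/and3P=> fT Ti zuT; have := kelt_kbasis i T alj; rewrite fT Ti => /andP[Tb degT].
have lt : (index (kelt j al T) (kbasis J i j) < size (kbasis J i j))%N by rewrite index_mem.
apply: contraNneq zuT => /matrixP/(_ (Ordinal lt) (Ordinal lt)).
by rewrite !mxE /= nth_index // eqxx /E degT mulrC => ->.
Qed.

Lemma betti0_vertexless al : face al set0 -> (forall x, ~~ face al [set x]) ->
  betti k J 0 (\sum_t al t) <> 0%N.
Proof.
move=> f0 f1; have card0 T : face al T && (#|T| == 0%N) = (T == set0).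
  by rewrite cards_eq0; case: eqP => [->|]; rewrite ?f0 ?andbF.
pose z T : k := (T == set0)%:R.
apply: (betti_neq0 (al := al) (z := z) (u := z)) => // [U _ _ | S fS /eqP/cards1P[x Sx] |].
- by rewrite (eq_bigl _ _ card0) big_pred1_eq bdE big_set0 mulr0.
- by have := f1 x; rewrite -Sx fS.
- by rewrite (eq_bigl _ _ card0) big_pred1_eq /z eqxx mulr1.
Qed.

Lemma sum_delta (P : pred {set 'I_4}) A (F : {set 'I_4} -> k) : P A ->
  \sum_(T | P T) (T == A)%:R * F T = F A.
Proof.
move=> PA; rewrite (bigD1 A) //= eqxx mul1r big1 ?addr0 // => T /andP[_ /negPf->].
by rewrite mul0r.
Qed.

Lemma mem_uniq4 (x y z w : 'I_4) : uniq [:: x; y; z; w] -> forall t, t \in [:: x; y; z; w].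
Proof.
move=> u4 t; suff -> : [:: x; y; z; w] =i 'I_4 by [].
apply/subset_cardP; last exact/subsetP.
by rewrite card_ord; apply/card_uniqP.
Qed.

(** The cycle is [x] minus [z]. The cocycle is the indicator of [x] and [y], constant along edges
    because none leaves this pair. *)
Lemma betti1_disconnected al (x y z w : 'I_4) : uniq [:: x; y; z; w] ->
  face al [set x] -> face al [set z] ->
  ~~ face al [set x; z] -> ~~ face al [set x; w] ->
  ~~ face al [set y; z] -> ~~ face al [set y; w] ->
  betti k J 1 (\sum_t al t) <> 0%N.
Proof.
move=> u4 fx fz nxz nxw nyz nyw; have cov := mem_uniq4 u4.
move: u4; rewrite /= !inE !negb_or => /and4P[/and3P[xy xz xw] /andP[yz yw] zw _].
pose c T : k := (T == [set x])%:R - (T == [set z])%:R.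
pose u T : k := (T == [set x])%:R + (T == [set y])%:R.
have sumc F : \sum_(T | face al T && (#|T| == 1)) c T * F T = F [set x] - F [set z].
  under eq_bigr do rewrite mulrBl.
  by rewrite sumrB !sum_delta ?cards1 ?fx ?fz.
have eq1 (p q : 'I_4) : ([set p] == [set q]) = (p == q) by rewrite (inj_eq set1_inj).
apply: (betti_neq0 (al := al) (z := c) (u := u)) => // [U _ /eqP | S fS /eqP/cards2P[p [q [pq Spq]]] |].
- rewrite cards_eq0 => /eqP->; rewrite sumc !bdE !big_set1 !setDv eqxx.
  by rewrite !sgn1 subrr.
- rewrite {S}Spq in fS *.
  rewrite sum_pair // pairD1l // pairD1r // sgn_pairl // sgn_pairr // mulNr -mulrBr.
  suff -> : u [set q] = u [set p] by rewrite subrr mulr0.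
  rewrite /u !eq1.
  have := cov q; have := cov p; rewrite !inE.
  case/or4P => /eqP ep; case/or4P => /eqP eq; move: pq fS; rewrite ep eq ?eqxx //;
  rewrite ?(setUC [set z]) ?(setUC [set w]) ?(negPf nxz) ?(negPf nxw) ?(negPf nyz) ?(negPf nyw) //;
  rewrite -?[y == x]eq_sym -?[z == x]eq_sym -?[w == x]eq_sym -?[z == y]eq_sym -?[w == y]eq_sym;
  by rewrite ?(negPf xy) ?(negPf xz) ?(negPf xw) ?(negPf yz) ?(negPf yw) ?addr0 ?add0r.
- rewrite sumc /u !eq1 eqxx (negPf xy) (eq_sym z x) (negPf xz) (eq_sym z y) (negPf yz).
  by rewrite !addr0 subr0.
Qed.

(** The cycle runs through [x], [z], [y], [w]; the cocycle is dual to the edge from [x] to [z]. A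
    triangle on that edge would contain a missing diagonal. *)
Lemma betti2_square al (x y z w : 'I_4) : uniq [:: x; y; z; w] ->
  face al [set x; z] -> face al [set z; y] -> face al [set y; w] -> face al [set w; x] ->
  ~~ face al [set x; y] -> ~~ face al [set z; w] ->
  betti k J 2 (\sum_t al t) <> 0%N.
Proof.
move=> u4 fxz fzy fyw fwx nxy nzw; have cov := mem_uniq4 u4.
move: u4; rewrite /= !inE !negb_or => /and4P[/and3P[xy xz xw] /andP[yz yw] zw _].
pose c T := edge x z T + edge z y T + edge y w T + edge w x T.
apply: (betti_neq0 (al := al) (z := c) (u := edge x z)) => // [U _ _ | S fS S3 |].
- under eq_bigr do rewrite /c !mulrDl.
  by rewrite !big_split /= !bd_edge; [ring | right..].
- apply: big1 => s sS; rewrite /edge xz /=; case: eqP => [SD|_]; last by rewrite mulr0.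
  have [xS zS] : x \in S /\ z \in S.
    by split; apply: (subsetP (subD1set S s)); rewrite SD !inE eqxx ?orbT.
  have sub p q : p \in S -> q \in S -> face al [set p; q].
    by move=> pS qS; apply: face_sub fS; apply/subsetP => t; rewrite !inE => /orP[] /eqP->.
  have sD : s \notin [set x; z] by rewrite -SD !inE eqxx.
  have := cov s; rewrite !inE => /or4P[] /eqP es; move: sS sD; rewrite es !inE ?eqxx ?orbT //.
    by move/(sub _ _ xS); rewrite (negPf nxy).
  by move/(sub _ _ zS); rewrite (negPf nzw).
- rewrite (bigD1 [set x; z]) ?fxz ?cards2 ?xz //= big1 ?addr0; last first.
    by move=> T /andP[_ /negPf nT]; rewrite /edge nT andbF mulr0.
  have ne p q : y \in [set p; q] \/ w \in [set p; q] -> edge p q [set x; z] = 0.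
    rewrite /edge; case: ([set x; z] =P _) => [<-|]; rewrite ?andbF // !inE.
    by rewrite (eq_sym y x) (negPf xy) (negPf yz) (eq_sym w x) (negPf xw) (eq_sym w z) (negPf zw) => -[].
  rewrite /c (ne z y) ?(ne y w) ?(ne w x) ?addr0 ?inE ?eqxx ?orbT; try by [left | right].
  by rewrite /edge xz eqxx -expr2 sqrr_sign.
Qed.

End Koszul.

(** * Exponent vectors in four variables and linear inequalities *)

Lemma all_I4 (P : 'I_4 -> Prop) : P va -> P vb -> P vc -> P vd -> forall t, P t.
Proof.
move=> Pa Pb Pc Pd [[|[|[|[|//]]]] lt]; [move: Pa|move: Pb|move: Pc|move: Pd];
by congr P; apply: val_inj.
Qed.

Lemma forall_I4 (P : pred 'I_4) : [forall t, P t] = [&& P va, P vb, P vc & P vd].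
Proof.
apply/forallP/and4P => [all | [Pa Pb Pc Pd]]; first by split.
exact: all_I4.
Qed.

Lemma exists_I4 (P : pred 'I_4) : [exists t, P t] = [|| P va, P vb, P vc | P vd].
Proof. by apply: negb_inj; rewrite negb_exists forall_I4 !negb_or. Qed.

Lemma sum_I4 (f : 'I_4 -> nat) : \sum_t f t = f va + f vb + f vc + f vd.
Proof.
rewrite !big_ord_recl big_ord0 addn0 !addnA.
by congr (_ + _ + _ + _); congr f; apply: val_inj.
Qed.

Definition exps (a b c d : nat) : {ffun 'I_4 -> nat} := [ffun t : 'I_4 => nth 0 [:: a; b; c; d] t].

Definition opp_weight (a1 a2 a3 a4 a5 a6 : nat) :=
  maxn (a1 + a6) (maxn (a2 + a5) (a3 + a4)).

Definition reg_bound (a1 a2 a3 a4 a5 a6 : nat) :=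
  maxn (max_facet_weight a1 a2 a3 a4 a5 a6) (opp_weight a1 a2 a3 a4 a5 a6).

(** The orbit of (0,r,r,r,r,0) under permuting the variables, sorted by the opposite pair that
    vanishes; [r] is left implicit. *)
Definition square_weights (a1 a2 a3 a4 a5 a6 : nat) :=
  [|| [&& a1 == 0, a6 == 0, a2 == a3, a2 == a4 & a2 == a5],
      [&& a2 == 0, a5 == 0, a1 == a3, a1 == a4 & a1 == a6] |
      [&& a3 == 0, a4 == 0, a1 == a2, a1 == a5 & a1 == a6]].

(** Here [q] is the exponent of the apex of a cone. If [p = 0] then [b] is false, so slack one
    suffices; otherwise slack two is required. *)
Lemma leq_sub_slackr a p q (b : bool) :
  b <= p -> a + (0 < p) < p + q -> a <= p - b + (q - 1).
Proof. by case: b p => [] [|p]; lia. Qed.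

Lemma leq_sub_slackl a p q (b : bool) :
  b <= q -> a + (0 < q) < p + q -> a <= p - 1 + (q - b).
Proof. by case: b q => [] [|q]; lia. Qed.

Section Inequalities.
Variables (a1 a2 a3 a4 a5 a6 x y z w : nat).
Let N := reg_bound a1 a2 a3 a4 a5 a6.

Lemma reg_bound_lt m : N + m < x + y + z + w =
  [&& a1 + a2 + a3 + m < x + y + z + w, a1 + a4 + a5 + m < x + y + z + w,
      a2 + a4 + a6 + m < x + y + z + w, a3 + a5 + a6 + m < x + y + z + w,
      a1 + a6 + m < x + y + z + w, a2 + a5 + m < x + y + z + w & a3 + a4 + m < x + y + z + w].
Proof. rewrite /N /reg_bound /opp_weight /max_facet_weight; lia. Qed.

Hypothesis mem : [&& a1 <= x + y, a2 <= x + z, a3 <= x + w, a4 <= y + z, a5 <= y + w & a6 <= z + w].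

(** Without a vertex, the edges of slack zero cover all variables of positive exponent. A minimal
    cover is a star or two opposite edges, so the degree is at most a facet weight or a sum of
    opposite entries. *)
Lemma exists_vertex : N < x + y + z + w ->
  [|| [&& 0 < x, a1 < x + y, a2 < x + z & a3 < x + w],
      [&& 0 < y, a1 < x + y, a4 < y + z & a5 < y + w],
      [&& 0 < z, a2 < x + z, a4 < y + z & a6 < z + w] |
      [&& 0 < w, a3 < x + w, a5 < y + w & a6 < z + w]].
Proof. by rewrite -[N]addn0 reg_bound_lt; move: mem; lia. Qed.

(** The same covering argument with edges of slack at most one: two opposite edges raise the bound
    by at most two, a star by at most one. *)
Lemma exists_apex : N + 2 < x + y + z + w ->
  [|| [&& 0 < x, a1 + (0 < y) < x + y, a2 + (0 < z) < x + z & a3 + (0 < w) < x + w],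
      [&& 0 < y, a1 + (0 < x) < x + y, a4 + (0 < z) < y + z & a5 + (0 < w) < y + w],
      [&& 0 < z, a2 + (0 < x) < x + z, a4 + (0 < y) < y + z & a6 + (0 < w) < z + w] |
      [&& 0 < w, a3 + (0 < x) < x + w, a5 + (0 < y) < y + w & a6 + (0 < z) < z + w]].
Proof.
rewrite reg_bound_lt; move: mem.
by case: x y z w => [|x'] [|y'] [|z'] [|w']; rewrite /=; lia.
Qed.

(** The disjuncts are the empty graph, an isolated vertex beside others, and two pairs without
    crossing edges. For two pairs with all four vertices present, the crossing slacks are one, so
    two sums of opposite entries equal the degree minus two; comparison with the facet weights
    forces [square_weights]. *)
Lemma no_split : N + 1 < x + y + z + w -> ~~ square_weights a1 a2 a3 a4 a5 a6 ->
  let A := [&& 0 < x, a1 < x + y, a2 < x + z & a3 < x + w] in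
  let B := [&& 0 < y, a1 < x + y, a4 < y + z & a5 < y + w] in
  let C := [&& 0 < z, a2 < x + z, a4 < y + z & a6 < z + w] in
  let D := [&& 0 < w, a3 < x + w, a5 < y + w & a6 < z + w] in
  let ab := [&& A, B & a1 + 1 < x + y] in let ac := [&& A, C & a2 + 1 < x + z] in
  let ad := [&& A, D & a3 + 1 < x + w] in let bc := [&& B, C & a4 + 1 < y + z] in
  let bd := [&& B, D & a5 + 1 < y + w] in let cd := [&& C, D & a6 + 1 < z + w] in
  [|| ~~ [|| A, B, C | D],
      [&& A, [|| B, C | D], ~~ ab, ~~ ac & ~~ ad],
      [&& B, [|| A, C | D], ~~ ab, ~~ bc & ~~ bd],
      [&& C, [|| A, B | D], ~~ ac, ~~ bc & ~~ cd],
      [&& D, [|| A, B | C], ~~ ad, ~~ bd & ~~ cd],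
      [&& A || B, C || D, ~~ ac, ~~ ad, ~~ bc & ~~ bd],
      [&& A || C, B || D, ~~ ab, ~~ ad, ~~ bc & ~~ cd] |
      [&& A || D, B || C, ~~ ab, ~~ ac, ~~ bd & ~~ cd]] = false.
Proof.
rewrite reg_bound_lt => bnd; rewrite /square_weights => ns.
have H := mem; apply/negbTE; do ![apply/norP; split].
clear -H bnd; lia.
clear -H bnd; lia.
clear -H bnd; lia.
clear -H bnd; lia.
clear -H bnd; lia.
clear -H bnd ns; case: (boolP [&& 0 < x, _ & _]) => hA; case: (boolP [&& 0 < y, _ & _]) => hB;
  case: (boolP [&& 0 < z, _ & _]) => hC; case: (boolP [&& 0 < w, _ & _]) => hD; rewrite /=; lia.
clear -H bnd ns; case: (boolP [&& 0 < x, _ & _]) => hA; case: (boolP [&& 0 < y, _ & _]) => hB;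
  case: (boolP [&& 0 < z, _ & _]) => hC; case: (boolP [&& 0 < w, _ & _]) => hD; rewrite /=; lia.
clear -H bnd ns; case: (boolP [&& 0 < x, _ & _]) => hA; case: (boolP [&& 0 < y, _ & _]) => hB;
  case: (boolP [&& 0 < z, _ & _]) => hC; case: (boolP [&& 0 < w, _ & _]) => hD; rewrite /=; lia.
Qed.

End Inequalities.

(* A graph on at most four vertices is empty, has a dominating vertex or edge, or
   is disconnected; the vertices present are [A B C D]. *)
Lemma graph4 (A B C D ab ac ad bc bd cd : bool) :
  (ab -> A && B) -> (ac -> A && C) -> (ad -> A && D) ->
  (bc -> B && C) -> (bd -> B && D) -> (cd -> C && D) ->
  let star (ax bx cx dx : bool) := [&& A ==> ax, B ==> bx, C ==> cx & D ==> dx] in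
  let dom (e ax bx cx dx ay ey cy dy : bool) :=
    e && star (ax || ay) (bx || ey) (cx || cy) (dx || dy) in
  [|| dom A A ab ac ad A ab ac ad, dom B ab B bc bd ab B bc bd,
      dom C ac bc C cd ac bc C cd, dom D ad bd cd D ad bd cd D,
      dom ab A ab ac ad ab B bc bd, dom ac A ab ac ad ac bc C cd,
      dom ad A ab ac ad ad bd cd D, dom bc ab B bc bd ac bc C cd,
      dom bd ab B bc bd ad bd cd D | dom cd ac bc C cd ad bd cd D] ||
  [|| ~~ [|| A, B, C | D],
      [&& A, [|| B, C | D], ~~ ab, ~~ ac & ~~ ad],
      [&& B, [|| A, C | D], ~~ ab, ~~ bc & ~~ bd],
      [&& C, [|| A, B | D], ~~ ac, ~~ bc & ~~ cd],
      [&& D, [|| A, B | C], ~~ ad, ~~ bd & ~~ cd],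
      [&& A || B, C || D, ~~ ac, ~~ ad, ~~ bc & ~~ bd],
      [&& A || C, B || D, ~~ ab, ~~ ad, ~~ bc & ~~ cd] |
      [&& A || D, B || C, ~~ ab, ~~ ac, ~~ bd & ~~ cd]].
Proof.
by case: A B C D => [] [] [] []; case: ab => // H1; case: ac => // H2; case: ad => // H3;
case: bc => // H4; case: bd => // H5; case: cd => // H6; move: H1 H2 H3 H4 H5 H6;
do ?[move/(_ isT) => //].
Qed.

(** * Betti numbers of tetrahedral curves *)

Section Tetra.
Variables (k : fieldType) (a1 a2 a3 a4 a5 a6 : nat).
Let J := tetra_ideal a1 a2 a3 a4 a5 a6.
Let N := reg_bound a1 a2 a3 a4 a5 a6.

Lemma tetra_up (e e' : 'I_4 -> nat) : (forall t, e t <= e' t) -> J e -> J e'.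
Proof.
move=> le; have := (le va, le vb, le vc, le vd) => -[[[la lb] lc] ld].
rewrite /J /tetra_ideal; lia.
Qed.

Lemma tetra_face al (S : {set 'I_4}) : face J al S =
  [&& [&& (va \in S) <= al va, (vb \in S) <= al vb, (vc \in S) <= al vc & (vd \in S) <= al vd] &
    tetra_ideal a1 a2 a3 a4 a5 a6 (fun t => al t - (t \in S))].
Proof. by rewrite /face forall_I4. Qed.

Lemma tetra_face0 (al : {ffun 'I_4 -> nat}) : face J al set0 = J al.
Proof. by rewrite tetra_face /J /tetra_ideal !inE !subn0. Qed.

Lemma tetra_face1 (al : {ffun 'I_4 -> nat}) : J al ->
  (face J al [set va] =
     [&& 0 < al va, a1 < al va + al vb, a2 < al va + al vc & a3 < al va + al vd]) *
  (face J al [set vb] =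
     [&& 0 < al vb, a1 < al va + al vb, a4 < al vb + al vc & a5 < al vb + al vd]) *
  (face J al [set vc] =
     [&& 0 < al vc, a2 < al va + al vc, a4 < al vb + al vc & a6 < al vc + al vd]) *
  (face J al [set vd] =
     [&& 0 < al vd, a3 < al va + al vd, a5 < al vb + al vd & a6 < al vc + al vd]).
Proof.
rewrite !tetra_face /J /tetra_ideal !inE /=.
move: (al va) (al vb) (al vc) (al vd) => x y z w Jal; do !split; lia.
Qed.

Lemma tetra_face2 (al : {ffun 'I_4 -> nat}) : J al ->
  (face J al [set va; vb] =
     [&& face J al [set va], face J al [set vb] & a1 + 1 < al va + al vb]) *
  (face J al [set va; vc] =
     [&& face J al [set va], face J al [set vc] & a2 + 1 < al va + al vc]) *
  (face J al [set va; vd] =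
     [&& face J al [set va], face J al [set vd] & a3 + 1 < al va + al vd]) *
  (face J al [set vb; vc] =
     [&& face J al [set vb], face J al [set vc] & a4 + 1 < al vb + al vc]) *
  (face J al [set vb; vd] =
     [&& face J al [set vb], face J al [set vd] & a5 + 1 < al vb + al vd]) *
  (face J al [set vc; vd] =
     [&& face J al [set vc], face J al [set vd] & a6 + 1 < al vc + al vd]).
Proof.
move=> Jal; rewrite !(tetra_face1 Jal); move: Jal.
rewrite !tetra_face /J /tetra_ideal !inE /=.
move: (al va) (al vb) (al vc) (al vd) => x y z w Jal; do !split; lia.
Qed.

(** An edge at the apex loses at most one at each end, and nothing at an end of exponent zero; the
    summands such as [(0 < y)] record this. *)
Lemma tetra_cone (al : {ffun 'I_4 -> nat}) (S : {set 'I_4}) : face J al S ->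
  let x := al va in let y := al vb in let z := al vc in let w := al vd in
  [/\ [&& 0 < x, a1 + (0 < y) < x + y, a2 + (0 < z) < x + z & a3 + (0 < w) < x + w] ->
        face J al (va |: S),
      [&& 0 < y, a1 + (0 < x) < x + y, a4 + (0 < z) < y + z & a5 + (0 < w) < y + w] ->
        face J al (vb |: S),
      [&& 0 < z, a2 + (0 < x) < x + z, a4 + (0 < y) < y + z & a6 + (0 < w) < z + w] ->
        face J al (vc |: S) &
      [&& 0 < w, a3 + (0 < x) < x + w, a5 + (0 < y) < y + w & a6 + (0 < z) < z + w] ->
        face J al (vd |: S)].
Proof.
rewrite !tetra_face /tetra_ideal !inE /=.
case/andP=> [/and4P[? ? ? ?] /and5P[? ? ? ? /andP[? ?]]].
by split=> /and4P[? ? ? ?]; do ![apply/andP; split] => //;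
  first [exact: leq_sub_slackl | exact: leq_sub_slackr].
Qed.

Lemma betti0_bound j : N < j -> betti k J 0 j = 0.
Proof.
move=> Nj; apply: betti_cone; first exact: tetra_up.
move=> al; rewrite sum_I4 tetra_face0 => alj Jal; rewrite -alj in Nj.
have [x fx] : exists x, face J al [set x].
  by apply/existsP; rewrite exists_I4 !(tetra_face1 Jal); apply: exists_vertex.
by exists x => S _ /cards0_eq->; rewrite setU0.
Qed.

(** The complex is a cone in every such multidegree. For [i >= 2], exceeding [i + N] implies
    exceeding [N + 2]. *)
Lemma betti_bound3 i j : N + 2 < j -> betti k J i j = 0.
Proof.
move=> Nj; apply: betti_cone; first exact: tetra_up.
move=> al; rewrite sum_I4 tetra_face0 => alj Jal; rewrite -alj in Nj.
have /or4P[] := exists_apex Jal Nj => cone; [exists va|exists vb|exists vc|exists vd];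
  by move=> S /tetra_cone[? ? ? ?] _; auto.
Qed.

Let M := max_facet_weight a1 a2 a3 a4 a5 a6.

Lemma betti1_bound j : N + 1 < j -> ~~ square_weights a1 a2 a3 a4 a5 a6 -> betti k J 1 j = 0.
Proof.
move=> Nj nsq; apply: betti1_connected; first exact: tetra_up.
move=> al v; rewrite sum_I4 => alj fv; rewrite -alj in Nj.
have f0 : face J al set0 by apply: face_sub fv; [apply: tetra_up | rewrite sub0set].
have Jal : J al by rewrite tetra_face0 in f0.
have fC p q : face J al [set p; q] = face J al [set q; p] by rewrite setUC.
have dom x y : face J al [set x; y] &&
    [forall w, face J al [set w] ==> face J al [set x; w] || face J al [set y; w]] ->
  exists x y, face J al [set x; y] /\
    forall w, face J al [set w] -> face J al [set x; w] \/ face J al [set y; w].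
  case/andP=> fxy /forallP fw; exists x, y; split=> // w /(implyP (fw w)).
  by move/orP.
have sub p q : face J al [set p; q] -> face J al [set p] && face J al [set q].
  by move=> fpq; apply/andP; split; apply: face_sub fpq; rewrite ?sub1set ?inE ?eqxx ?orbT //;
    apply: tetra_up.
(* [no_split] excludes the second half of [graph4]. In the first half, a dominating vertex is
   treated as a degenerate edge from it to itself. *)
have := graph4 (sub va vb) (sub va vc) (sub va vd) (sub vb vc) (sub vb vd) (sub vc vd).
have /= ns := no_split Jal Nj nsq.
rewrite /= !(tetra_face2 Jal) !(tetra_face1 Jal) ns orbF.
rewrite -!(tetra_face1 Jal) -!(tetra_face2 Jal) /=.
case/or4P=> [d|d|d|/or4P[d|d|d|/or4P[d|d|d|d]]];
  [apply: (dom va va) | apply: (dom vb vb) | apply: (dom vc vc) | apply: (dom vd vd) |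
   apply: (dom va vb) | apply: (dom va vc) | apply: (dom va vd) | apply: (dom vb vc) |
   apply: (dom vb vd) | apply: (dom vc vd)];
  by rewrite forall_I4 ?(fC vb va) ?(fC vc va) ?(fC vd va) ?(fC vc vb) ?(fC vd vb) ?(fC vd vc) ?setUid.
Qed.

(** In the chosen multidegree ab and cd have slack one, ac has slack two, and the facet inequalities
    give ad, bc and bd slack at least two: a 4-cycle. The next two lemmas are relabelled
    versions. *)
Lemma betti2_ab_cd : M < a1 + a6 -> betti k J 2 (a1 + a6 + 2) <> 0.
Proof.
rewrite /M /max_facet_weight !gtn_max => /and4P[lt1 lt2 lt3 lt4].
have -> : a1 + a6 + 2 = \sum_t exps (a2 + 1) (a1 - a2) 1 a6 t.
  by rewrite sum_I4 !ffunE /=; lia.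
by apply: (betti2_square tetra_up (_ : uniq [:: va; vb; vc; vd]));
  rewrite // tetra_face /tetra_ideal !inE !ffunE /=; lia.
Qed.

Lemma betti2_ac_bd : M < a2 + a5 -> betti k J 2 (a2 + a5 + 2) <> 0.
Proof.
rewrite /M /max_facet_weight !gtn_max => /and4P[lt1 lt2 lt3 lt4].
have -> : a2 + a5 + 2 = \sum_t exps (a1 + 1) 1 (a2 - a1) a5 t.
  by rewrite sum_I4 !ffunE /=; lia.
by apply: (betti2_square tetra_up (_ : uniq [:: va; vc; vb; vd]));
  rewrite // tetra_face /tetra_ideal !inE !ffunE /=; lia.
Qed.

Lemma betti2_ad_bc : M < a3 + a4 -> betti k J 2 (a3 + a4 + 2) <> 0.
Proof.
rewrite /M /max_facet_weight !gtn_max => /and4P[lt1 lt2 lt3 lt4].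
have -> : a3 + a4 + 2 = \sum_t exps (a2 + 1) a4 1 (a3 - a2) t.
  by rewrite sum_I4 !ffunE /=; lia.
by apply: (betti2_square tetra_up (_ : uniq [:: va; vd; vc; vb]));
  rewrite // tetra_face /tetra_ideal !inE !ffunE /=; lia.
Qed.

(** A facet consists of the edges at one variable. A minimal generator free of that variable has its
    other exponents at least the three entries, so its degree reaches the facet weight. *)
Lemma betti0_facets : exists2 j, M <= j & betti k J 0 j <> 0.
Proof.
(* [B] bounds every entry, so [B] on three variables and 0 on the fourth gives a monomial of [J];
   its divisors keep the exponent 0. *)
pose B := a1 + a2 + a3 + a4 + a5 + a6.
have gen (al : {ffun 'I_4 -> nat}) : J al -> exists be : {ffun 'I_4 -> nat},
    [/\ forall t, be t <= al t, J be & betti k J 0 (\sum_t be t) <> 0].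
  move=> Jal; have f0 : face J al set0 by rewrite tetra_face0.
  have [be [le fb f1]] := exists_vertexless tetra_up f0.
  exists be; split=> //; first by rewrite tetra_face0 in fb.
  by apply: betti0_vertexless => //; apply: tetra_up.
have : [|| M == a1 + a2 + a3, M == a1 + a4 + a5, M == a2 + a4 + a6 | M == a3 + a5 + a6].
  by rewrite /M /max_facet_weight; lia.
case/or4P=> /eqP m.
- have [|be [le Jbe nz]] := gen (exps 0 B B B); first by rewrite /J /tetra_ideal !ffunE /= /B; lia.
  exists (\sum_t be t) => //; rewrite sum_I4 m; have := le va; rewrite ffunE /=.
  by case/and5P: Jbe; lia.
- have [|be [le Jbe nz]] := gen (exps B 0 B B); first by rewrite /J /tetra_ideal !ffunE /= /B; lia.
  exists (\sum_t be t) => //; rewrite sum_I4 m; have := le vb; rewrite ffunE /=.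
  by case/and5P: Jbe; lia.
- have [|be [le Jbe nz]] := gen (exps B B 0 B); first by rewrite /J /tetra_ideal !ffunE /= /B; lia.
  exists (\sum_t be t) => //; rewrite sum_I4 m; have := le vc; rewrite ffunE /=.
  by case/and5P: Jbe; lia.
- have [|be [le Jbe nz]] := gen (exps B B B 0); first by rewrite /J /tetra_ideal !ffunE /= /B; lia.
  exists (\sum_t be t) => //; rewrite sum_I4 m; have := le vd; rewrite ffunE /=.
  by case/and5P: Jbe; lia.
Qed.

Lemma betti_bound i j :
  ~~ square_weights a1 a2 a3 a4 a5 a6 -> betti k J i j <> 0 -> j <= i + N.
Proof.
move=> nsq nz; rewrite leqNgt; apply/negP => lt; apply: nz.
case: i lt => [|[|i]] lt; first exact: betti0_bound.
  by apply: betti1_bound => //; rewrite addn1.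
by apply: betti_bound3; apply: leq_ltn_trans lt; rewrite addnC leq_add2r.
Qed.

Lemma opp_weight_cases : M < opp_weight a1 a2 a3 a4 a5 a6 ->
  [\/ M < a1 + a6 /\ N = a1 + a6, M < a2 + a5 /\ N = a2 + a5 | M < a3 + a4 /\ N = a3 + a4].
Proof.
rewrite /N /reg_bound -/M => lt; rewrite (maxn_idPr (ltnW lt)).
have : [|| opp_weight a1 a2 a3 a4 a5 a6 == a1 + a6, opp_weight a1 a2 a3 a4 a5 a6 == a2 + a5 |
    opp_weight a1 a2 a3 a4 a5 a6 == a3 + a4] by rewrite /opp_weight; lia.
by case/or3P=> /eqP eN; rewrite eN in lt *; [constructor 1|constructor 2|constructor 3].
Qed.

Lemma betti2_opp : M < opp_weight a1 a2 a3 a4 a5 a6 -> betti k J 2 (N + 2) <> 0.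
Proof.
by case/opp_weight_cases=> -[lt ->]; [apply: betti2_ab_cd|apply: betti2_ac_bd|apply: betti2_ad_bc].
Qed.

(* None of (A)-(D) holds iff some pair of opposite edges outweighs every facet. *)
Lemma irreducible_opp_weight :
  [&& ~~ [&& a4 <= a1 + a2, a5 <= a1 + a3 & a6 <= a2 + a3],
      ~~ [&& a2 <= a1 + a4, a3 <= a1 + a5 & a6 <= a4 + a5],
      ~~ [&& a1 <= a2 + a4, a3 <= a2 + a6 & a5 <= a4 + a6] &
      ~~ [&& a1 <= a3 + a5, a2 <= a3 + a6 & a4 <= a5 + a6]] =
  (M < opp_weight a1 a2 a3 a4 a5 a6).
Proof.
rewrite /M /max_facet_weight /opp_weight !leq_max !gtn_max.
apply/idP/idP; last by case/or3P=> /and4P[*]; lia.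
rewrite !negb_and -!ltnNge => /and4P[].
by case/or3P=> ?; case/or3P=> ?; case/or3P=> ?; case/or3P=> ?; lia.
Qed.

(** The non-ACM clause comes from the 4-cycle, which makes [betti] nonzero in homological degree
    2. *)
Lemma minimal_curveP :
  minimal_curve k a1 a2 a3 a4 a5 a6 <-> M < opp_weight a1 a2 a3 a4 a5 a6.
Proof.
rewrite -irreducible_opp_weight; split=> [[_ [/negP ? [/negP ? [/negP ? /negP ?]]]]|irr].
  by apply/and4P.
split; last by case/and4P: irr => /negP ? /negP ? /negP ? /negP ?.
by move=> acm; apply: betti2_opp (acm 2 _ isT); rewrite -irreducible_opp_weight.
Qed.

End Tetra.

(** * Recovering the entries from the ideal *)

Lemma tetra_ideal_le a1 a2 a3 a4 a5 a6 b1 b2 b3 b4 b5 b6 :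
  (forall e, tetra_ideal a1 a2 a3 a4 a5 a6 e -> tetra_ideal b1 b2 b3 b4 b5 b6 e) ->
  [&& b1 <= a1, b2 <= a2, b3 <= a3, b4 <= a4, b5 <= a5 & b6 <= a6].
Proof.
move=> sub; pose B := a1 + a2 + a3 + a4 + a5 + a6.
have {}sub x y z w := sub (exps x y z w); rewrite /tetra_ideal in sub.
have test x y z w : [&& a1 <= x + y, a2 <= x + z, a3 <= x + w, a4 <= y + z, a5 <= y + w & a6 <= z + w] ->
    [&& b1 <= x + y, b2 <= x + z, b3 <= x + w, b4 <= y + z, b5 <= y + w & b6 <= z + w].
  by have := sub x y z w; rewrite !ffunE.
(* Each test monomial meets one edge condition with equality and has exponent [B] on the other two
   variables, which isolates one entry. *)
have t1 := test a1 0 B B; have t2 := test a2 B 0 B; have t3 := test a3 B B 0.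
have t4 := test B a4 0 B; have t5 := test B a5 B 0; have t6 := test B B a6 0.
move: t1 t2 t3 t4 t5 t6; rewrite /B; clear; move=> t1 t2 t3 t4 t5 t6.
do ![apply/andP; split]; [clear -t1 | clear -t2 | clear -t3 | clear -t4 | clear -t5 | clear -t6]; lia.
Qed.

Lemma tetra_ideal_inj a1 a2 a3 a4 a5 a6 b1 b2 b3 b4 b5 b6 :
  (forall e, tetra_ideal a1 a2 a3 a4 a5 a6 e = tetra_ideal b1 b2 b3 b4 b5 b6 e) ->
  [/\ a1 = b1, a2 = b2 & a3 = b3] /\ [/\ a4 = b4, a5 = b5 & a6 = b6].
Proof.
move=> eqT; have := @tetra_ideal_le a1 a2 a3 a4 a5 a6 b1 b2 b3 b4 b5 b6.
have := @tetra_ideal_le b1 b2 b3 b4 b5 b6 a1 a2 a3 a4 a5 a6.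
move=> /(_ (fun e => etrans (eqT e))) ba /(_ (fun e => etrans (esym (eqT e)))) ab.
by split; split; move: ab ba; lia.
Qed.

Definition square_form (a1 a2 a3 a4 a5 a6 r : nat) :=
  [\/ [:: a1; a2; a3; a4; a5; a6] = [:: 0; r; r; r; r; 0],
      [:: a1; a2; a3; a4; a5; a6] = [:: r; 0; r; r; 0; r] |
      [:: a1; a2; a3; a4; a5; a6] = [:: r; r; 0; 0; r; r]].

(** The ideal of (0,r,r,r,r,0) constrains exactly the pairs crossing the cut between {a,b} and
    {c,d}. A permutation moves this cut to one of the three splittings into pairs, and
    [tetra_ideal_inj] reads off the entries. *)
Lemma special_square a1 a2 a3 a4 a5 a6 r :
  special_form a1 a2 a3 a4 a5 a6 r -> square_form a1 a2 a3 a4 a5 a6 r.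
Proof.
case=> s eqT; pose c x : bool := (s^-1%g x < 2)%N.
have cut e : tetra_ideal 0 r r r r 0 (fun t => e (s t)) =
    [forall x, [forall y, (c x != c y) ==> (r <= e x + e y)]].
  transitivity [forall u : 'I_4, [forall v : 'I_4, ((u < 2) != (v < 2)) ==> (r <= e (s u) + e (s v))]].
    by rewrite !forall_I4 /tetra_ideal /=; lia.
  apply/forallP/forallP => cutP x; apply/forallP => y.
    by have := forallP (cutP (s^-1%g x)) (s^-1%g y); rewrite !permKV.
  by have := forallP (cutP (s x)) (s y); rewrite /c !permK.
have count : c va + c vb + c vc + c vd = 2.
  rewrite -(sum_I4 (fun t => c t : nat)) (reindex_inj (@perm_inj _ s)) /=.
  under eq_bigr do rewrite /c permK.
  by rewrite sum_I4.
have {}eqT e := etrans (eqT e) (cut e).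
have {}eqT e : tetra_ideal a1 a2 a3 a4 a5 a6 e =
   [&& (c va != c vb) ==> (r <= e va + e vb), (c va != c vc) ==> (r <= e va + e vc),
       (c va != c vd) ==> (r <= e va + e vd), (c vb != c vc) ==> (r <= e vb + e vc),
       (c vb != c vd) ==> (r <= e vb + e vd) & (c vc != c vd) ==> (r <= e vc + e vd)].
  rewrite eqT !forall_I4 /= !eqxx /=.
  by case: (c va) (c vb) (c vc) (c vd) => [] [] [] []; rewrite /=; lia.
(* Six colourings with two variables on each side remain; complementary ones give the same form. *)
move: count eqT; case: (c va) (c vb) (c vc) (c vd) => [] [] [] [] //= _ eqT;
  [constructor 1|constructor 2|constructor 3|constructor 3|constructor 2|constructor 1];
  [have := @tetra_ideal_inj a1 a2 a3 a4 a5 a6 0 r r r r 0 |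
   have := @tetra_ideal_inj a1 a2 a3 a4 a5 a6 r 0 r r 0 r |
   have := @tetra_ideal_inj a1 a2 a3 a4 a5 a6 r r 0 0 r r |
   have := @tetra_ideal_inj a1 a2 a3 a4 a5 a6 r r 0 0 r r |
   have := @tetra_ideal_inj a1 a2 a3 a4 a5 a6 r 0 r r 0 r |
   have := @tetra_ideal_inj a1 a2 a3 a4 a5 a6 0 r r r r 0];
  by case=> [e|[-> -> ->] [-> -> ->]] //; rewrite eqT /tetra_ideal /= ?andbT.
Qed.

Lemma square_special a1 a2 a3 a4 a5 a6 :
  square_weights a1 a2 a3 a4 a5 a6 -> exists r, special_form a1 a2 a3 a4 a5 a6 r.
Proof.
case/or3P=> /and5P[/eqP-> /eqP-> /eqP<- /eqP<- /eqP<-].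
- by exists a2, 1%g => e; rewrite /tetra_ideal !perm1.
- exists a1, (tperm vb vc) => e; rewrite /tetra_ideal tpermL tpermR !tpermD //.
  by rewrite (addnC (e vc) (e vb)) /=; lia.
- exists a1, (tperm vb vd) => e; rewrite /tetra_ideal tpermL tpermR !tpermD //.
  by rewrite (addnC (e vd) (e vc)) (addnC (e vd) (e vb)) (addnC (e vc) (e vb)) /=; lia.
Qed.

(** * Regularity *)

(** For the first form, in multidegree (1,1,r,r) all edges between {a,b} and {c,d} have slack one,
    which disconnects the graph. *)
Lemma betti1_square (k : fieldType) a1 a2 a3 a4 a5 a6 r : 0 < r ->
  square_form a1 a2 a3 a4 a5 a6 r ->
  betti k (tetra_ideal a1 a2 a3 a4 a5 a6) 1 (2 * r + 2) <> 0.
Proof.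
move=> r0 [] [-> -> -> -> -> ->].
- have -> : 2 * r + 2 = \sum_t exps 1 1 r r t by rewrite sum_I4 !ffunE /=; lia.
  by apply: (betti1_disconnected (@tetra_up _ _ _ _ _ _) (_ : uniq [:: va; vb; vc; vd]));
    rewrite // tetra_face /tetra_ideal !inE !ffunE /=; lia.
- have -> : 2 * r + 2 = \sum_t exps 1 r 1 r t by rewrite sum_I4 !ffunE /=; lia.
  by apply: (betti1_disconnected (@tetra_up _ _ _ _ _ _) (_ : uniq [:: va; vc; vb; vd]));
    rewrite // tetra_face /tetra_ideal !inE !ffunE /=; lia.
- have -> : 2 * r + 2 = \sum_t exps 1 r r 1 t by rewrite sum_I4 !ffunE /=; lia.
  by apply: (betti1_disconnected (@tetra_up _ _ _ _ _ _) (_ : uniq [:: va; vd; vb; vc]));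
    rewrite // tetra_face /tetra_ideal !inE !ffunE /=; lia.
Qed.

Lemma reg_square (k : fieldType) a1 a2 a3 a4 a5 a6 r : 0 < r ->
  square_form a1 a2 a3 a4 a5 a6 r ->
  is_reg k (tetra_ideal a1 a2 a3 a4 a5 a6) (2 * r + 1).
Proof.
move=> r0 sq; apply: is_reg_intro.
  exists 1, (2 * r + 2); split; first exact: betti1_square.
  by rewrite addnCA addnC -addnA.
have eN : reg_bound a1 a2 a3 a4 a5 a6 = 2 * r.
  case: sq => -[-> -> -> -> -> ->];
  by rewrite /reg_bound /opp_weight /max_facet_weight; lia.
move=> i j nz; rewrite leqNgt; apply/negP => lt; apply: nz.
(* In positive homological degree, [j > i + (2 * r + 1)] already gives [j > reg_bound + 2]. *)
case: i lt => [|i] lt; first by apply: betti0_bound; rewrite eN; lia.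
by apply: betti_bound3; rewrite eN; lia.
Qed.

(** Both sides are twice the common entry, so these curves are never minimal. *)
Lemma square_opp_weight a1 a2 a3 a4 a5 a6 : square_weights a1 a2 a3 a4 a5 a6 ->
  opp_weight a1 a2 a3 a4 a5 a6 <= max_facet_weight a1 a2 a3 a4 a5 a6.
Proof.
by case/or3P=> /and5P[/eqP-> /eqP-> /eqP<- /eqP<- /eqP<-];
  rewrite /opp_weight /max_facet_weight; lia.
Qed.

Theorem theorem5p6 (k : fieldType) (a1 a2 a3 a4 a5 a6 : nat) :
  ~ [&& a1 == 0, a2 == 0, a3 == 0, a4 == 0, a5 == 0 & a6 == 0] ->
  (forall r, special_form a1 a2 a3 a4 a5 a6 r ->
     is_reg k (tetra_ideal a1 a2 a3 a4 a5 a6) (2 * r + 1)) /\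
  (minimal_curve k a1 a2 a3 a4 a5 a6 ->
     forall m, m < 6 ->
       (forall i, i < 6 -> entry a1 a2 a3 a4 a5 a6 i <= entry a1 a2 a3 a4 a5 a6 m) ->
       is_reg k (tetra_ideal a1 a2 a3 a4 a5 a6)
         (entry a1 a2 a3 a4 a5 a6 m + entry a1 a2 a3 a4 a5 a6 (5 - m)) /\
       max_facet_weight a1 a2 a3 a4 a5 a6 <
         entry a1 a2 a3 a4 a5 a6 m + entry a1 a2 a3 a4 a5 a6 (5 - m)) /\
  (~ minimal_curve k a1 a2 a3 a4 a5 a6 ->
     ~ (exists r, special_form a1 a2 a3 a4 a5 a6 r) ->
     is_reg k (tetra_ideal a1 a2 a3 a4 a5 a6) (max_facet_weight a1 a2 a3 a4 a5 a6)).
Proof.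
move=> nontrivial; split; last split.
(* The case [r = 0] has to be excluded: the ideal is then the whole ring, of regularity 0. *)
- move=> r /special_square sq; apply: reg_square => //; rewrite lt0n.
  by apply: contra_notN nontrivial => /eqP r0; case: sq => -[-> -> -> -> -> ->]; rewrite r0.
- move=> /minimal_curveP ltMO m m6 max_m.
  have -> : entry a1 a2 a3 a4 a5 a6 m + entry a1 a2 a3 a4 a5 a6 (5 - m) =
      reg_bound a1 a2 a3 a4 a5 a6.
    (* When an opposite pair outweighs every facet, each of its two entries strictly exceeds the
       other four, so a largest entry belongs to it. *)
    have := max_m 0 isT; have := max_m 1 isT; have := max_m 2 isT.
    have := max_m 3 isT; have := max_m 4 isT; have := max_m 5 isT.
    case/opp_weight_cases: (ltMO) => -[]; rewrite /max_facet_weight !gtn_max => /and4P[? ? ? ?] ->;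
    case: m m6 {max_m} => [|[|[|[|[|[|//]]]]]] _; rewrite /entry /=; lia.
  split; last by apply: leq_trans ltMO _; apply: leq_maxr.
  apply: is_reg_intro.
    by exists 2, (reg_bound a1 a2 a3 a4 a5 a6 + 2); rewrite addnC; split=> //; rewrite addnC; apply: betti2_opp.
  move=> i j; apply: betti_bound; apply: contraL ltMO => /square_opp_weight.
  by rewrite -leqNgt.
- move=> /minimal_curveP/negP; rewrite -leqNgt => leOM nsp; apply: is_reg_intro.
    by have [j leMj nz] := betti0_facets k a1 a2 a3 a4 a5 a6; exists 0, j.
  move=> i j; have := @betti_bound k a1 a2 a3 a4 a5 a6 i j.
  (* As no opposite pair outweighs the facets, the upper bound is the maximal facet weight, which a
     minimal generator attains. *)
  rewrite {1}/reg_bound (maxn_idPl leOM); apply.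
  by apply/negP => /square_special.
Qed.
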